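(* Let $m \ge 2$, let $f \in \mathbb{R}[x_1,\dots,x_m]$ be a form of degree $n$, and let $\mathcal{Z}$ be a nonempty $\mathrm{SL}_m(\mathbb{Z})$-invariant subset of $\mathbb{Z}^m\setminus\{\vec 0\}$. If $f(\mathcal{Z})$ is discrete in $\mathbb{R}$, then $f$ is $\mathbb{Q}$-equivalent to a form in $n$ variables.
   Context: A form of degree $n$ in $m$ variables is a homogeneous polynomial $f(\vec x)\in\mathbb{R}[\vec x]$, $\vec x=(x_1,\dots,x_m)$, which factors as $f(\vec x)=l_1(\vec x)\cdots l_n(\vec x)$ with $l_1,\dots,l_n$ linear forms with complex coefficients that are linearly independent over $\mathbb{C}$ (so $n\le m$). The group $G=\mathrm{SL}_m(\mathbb{R})$ acts on $\mathbb{R}^m$ in the usual way and on $\mathbb{R}[\vec x]$ by $(gp)(\vec x)=p(g^{-1}\vec x)$. If $g\in \mathrm{SL}_m(\mathbb{Q})$, the forms $f$ and $gf$ are called $\mathbb{Q}$-equivalent. $f$ is said to be $\mathbb{Q}$-equivalent to a form in $n$ variables if there is $g\in\mathrm{SL}_m(\mathbb{Q})$ with $(gf)(x_1,\dots,x_m)=(gf)(x_1,\dots,x_n,0,\dots,0)$. A subset of $\mathbb{R}$ is called discrete in $\mathbb{R}$ if it has no accumulation point in $\mathbb{R}$ (i.e. it is closed and discrete). *)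

(* Defs.v *)
From HB Require Import structures.
From mathcomp Require Import all_boot all_order all_algebra.
From mathcomp Require Import complex.
From mathcomp Require mpoly.

Set Implicit Arguments.
Unset Strict Implicit.
Unset Printing Implicit Defensive.

Import GRing.Theory Num.Theory.
Local Open Scope ring_scope.

(* The notations of mpoly and of mathcomp-analysis cannot be active together,
   so those of mpoly are imported inside this module only. *)
Module Forms.
Import mpoly.

Section Action.
Variables (K : comUnitRingType) (m : nat).

(* The linear form  a_0 x_0 + ... + a_(m-1) x_(m-1). *)
Definition linear_form (a : 'rV[K]_m) : {mpoly K[m]} :=
  \sum_(j < m) a ord0 j *: 'X_j.

(* p(A x), where x is the column vector of the variables. *)
Definition mpoly_subst (A : 'M[K]_m) (p : {mpoly K[m]}) : {mpoly K[m]} :=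
  p \mPo [tuple linear_form (row i A) | i < m].

Definition mpoly_act (g : 'M[K]_m) (p : {mpoly K[m]}) : {mpoly K[m]} :=
  mpoly_subst (invmx g) p.

(* p(x_0, ..., x_(m-1)) = p(x_0, ..., x_(n-1), 0, ..., 0). *)
Definition in_first_variables (n : nat) (p : {mpoly K[m]}) : Prop :=
  p = p \mPo [tuple if (i < n)%N then 'X_i else 0 | i < m].

End Action.

(* The rows of L are the coefficient vectors of the linear forms l_1, ..., l_n. *)
Definition is_form (R : rcfType) (m n : nat) (f : {mpoly R[m]}) : Prop :=
  f \is n.-homog /\
  exists2 L : 'M[R[i]]_(n, m), row_free L &
    map_mpoly (real_complex R) f = \prod_(i < n) linear_form (row i L).

Definition Q_equivalent (R : rcfType) (m : nat) (f h : {mpoly R[m]}) : Prop :=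
  exists2 g : 'M[rat]_m, \det g = 1 & h = mpoly_act (map_mx ratr g) f.

Definition Q_equivalent_to_form_in (R : rcfType) (m n : nat)
    (f : {mpoly R[m]}) : Prop :=
  exists2 h : {mpoly R[m]}, Q_equivalent f h & in_first_variables n h.

Definition eval_int (R : comNzRingType) (m : nat) (f : {mpoly R[m]})
    (z : 'cV[int]_m) : R :=
  f.@[fun i => (z i ord0)%:~R].

End Forms.
Export Forms.

From mathcomp Require Import all_classical all_reals all_analysis.
Import numFieldNormedType.Exports.
Local Open Scope classical_set_scope.

Definition SLZ_invariant (m : nat) (Z : set 'cV[int]_m) : Prop :=
  forall g : 'M[int]_m, \det g = 1 -> forall z, Z z -> Z (g *m z).

Definition discrete_in (T : topologicalType) (S : set T) : Prop :=
  limit_point S = set0.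

(* Main.v *)
(** Let K be the common kernel of the l_i. The theorem amounts to K being spanned
    by rational vectors. By SL_m(Z)-invariance, Z contains d times every primitive
    vector for some d > 0, so f takes finitely many values of bounded size on
    primitive vectors.

    Fix an integer point x with f(x) <> 0. If v is integral with all l_i(v) tiny
    but not all zero, then x and v can be replaced by q and v1, where q + t v1 is
    primitive for every integer t, v1 divides v, and q has size controlled by x;
    moreover x lies in the span of q and v1. Then t |-> f(q + t v1) is a nonzero
    product of affine functions which are not all constant, hence a nonconstant
    polynomial of degree at most n, and it is bounded at about 1/|l(v1)| integers:
    too many for finitely many values. So the l_i cannot be simultaneously small
    at an integer point unless they all vanish there.

    The reduced row echelon form alpha of (l_1, ..., l_n) is real because f is, and
    Dirichlet's simultaneous approximation of a column of alpha yields integer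
    points at which all l_i are small, hence zero. So alpha is rational, and
    rational Gaussian elimination moves K to the span of the last m - n basis
    vectors. *)
From HB Require Import structures.
Require Import Defs.
From mathcomp Require Import all_boot all_order all_algebra.
From mathcomp Require Import complex reals.
From mathcomp Require mpoly.
From mathcomp Require Import ring lra zify.

Set Implicit Arguments.
Unset Strict Implicit.
Unset Printing Implicit Defensive.

Import Order.TTheory GRing.Theory Num.Theory.
Local Open Scope ring_scope.

(** * Primitive integer vectors *)

(* Bezout form of: the coordinates have greatest common divisor 1. *)
Definition primitive (m : nat) (z : 'cV[int]_m) : Prop :=
  exists u : 'rV[int]_m, u *m z = 1%:M.

(** The Smith form of a single column has one nontrivial entry. The dimension is at least 2 so that
    a second column is free to absorb signs. *)
Lemma SLZ_column_normal_form (m : nat) (z : 'cV[int]_m.+2) :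
  exists2 g : 'M[int]_m.+2, \det g = 1 &
    exists d : nat, z = g *m (d%:Z *: delta_mx 0 0).
Proof.
have [L uL [r ur [d _ ->]]] := int_Smith_normal_form z.
have [e [e2 De]] : exists e : int, e * e = 1 /\ \det L = e.
  exists (\det L); split=> //; move: uL; by rewrite unitmxE => /orP[] /eqP->.
pose c := d`_0 * r 0 0.
pose s : int := if 0 <= c then 1 else -1.
have s2 : s * s = 1 by rewrite /s; case: ifP.
(* The sign [s] makes the entry nonnegative, and [s * e] in the next column brings the determinant
   back to 1. *)
pose D : 'rV[int]_m.+2 := \row_j (if j == 0 then s else if j == 1 then s * e else 1).
exists (L *m diag_mx D).
  rewrite det_mulmx De det_diag !big_ord_recl big1 => [|i _]; last by rewrite mxE.
  rewrite !mxE /= mulr1; transitivity ((e * e) * (s * s)); last by rewrite e2 s2.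
  ring.
exists `|c|%N; rewrite -!mulmxA; congr (_ *m _).
apply/matrixP=> i j; rewrite !mxE (bigD1 0) //= big1 ?addr0 => [|k]; last first.
  by rewrite ord1.
rewrite (bigD1 0) //= big1 ?addr0 => [|k nk0]; last first.
  by rewrite !mxE (negbTE nk0) /= mulr0 mulr0.
rewrite !mxE !ord1 /=; case: (eqVneq i 0) => [->|ni] /=; last first.
  by rewrite -val_eqE /= in ni; rewrite (negbTE ni) !mulr0n !mul0r.
rewrite !mulr1n mulr1 -/c abszE /s; case: ifP => [c0|/negbT c0].
  by rewrite ger0_norm // mul1r.
by rewrite ltr0_norm 1?ltNge // mulrN mulN1r opprK.
Qed.

Lemma primitive_SLZ (m : nat) (g : 'M[int]_m.+1) :
  \det g = 1 -> primitive (g *m delta_mx 0 0).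
Proof.
move=> dg; exists (delta_mx 0 0 *m invmx g).
rewrite mulmxA mulmxKV ?unitmxE ?dg ?unitr1 // mul_delta_mx.
by apply/matrixP=> i j; rewrite !mxE !ord1.
Qed.

(** Here [d] is the gcd of the coordinates of [z]: both [z] and [d p] lie in the orbit of d e_0. *)
Lemma SLZ_orbit (m : nat) (z : 'cV[int]_m.+2) :
  z != 0 -> exists2 d : nat, (0 < d)%N &
    forall p, primitive p -> exists2 g, \det g = 1 & d%:Z *: p = g *m z.
Proof.
move=> z0; have [g dg [d zE]] := SLZ_column_normal_form z.
exists d; first by case: d zE z0 => // ->; rewrite scale0r mulmx0 eqxx.
move=> p [u up]; have [k dk [c pE]] := SLZ_column_normal_form p.
have c1 : c = 1%N.
  move: up; rewrite pE -scalemxAr -scalemxAr => /matrixP/(_ 0 0).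
  rewrite mxE [RHS]mxE eqxx => cu.
  have: (c%:Z %| true%:R)%Z by rewrite -cu dvdz_mulr.
  by rewrite mulr1n dvdz1 => /eqP.
exists (k *m invmx g); first by rewrite det_mulmx det_inv dg dk invr1 mulr1.
rewrite pE c1 zE mulmxA mulmxKV ?unitmxE ?dg ?unitr1 //.
by rewrite scale1r -scalemxAr.
Qed.

(** With [u], [u'] dual to [x], [w], the row r u + s u' takes the value r a + s b = 1. *)
Lemma primitive_comb (m : nat) (x w : 'cV[int]_m) (u u' : 'rV[int]_m)
    (a b r s : int) :
  u *m x = 1%:M -> u *m w = 0 -> u' *m x = 0 -> u' *m w = 1%:M ->
  r * a + s * b = 1 -> primitive (a *: x + b *: w).
Proof.
move=> ux uw u'x u'w ab; exists (r *: u + s *: u').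
rewrite mulmxDl !mulmxDr -!scalemxAl -!scalemxAr ux uw u'x u'w.
by rewrite !scaler0 addr0 add0r !scalerA -scalerDl ab scale1r.
Qed.

(* Any [x] with a coordinate 1 and any [v] not parallel to it can be replaced by
   a pair [q, v1] extending to a basis, with [v1] dividing [v] and [q] of size
   controlled by [x] and [v1]. *)
Lemma primitive_line (m : nat) (x v : 'cV[int]_m.+2) (i : 'I_m.+2) :
  x i 0 = 1 -> v != v i 0 *: x ->
  exists q v1 : 'cV[int]_m.+2, exists h b0 b : int,
  [/\ v = h *: v1, h != 0, 0 <= b < b0, b0 *: q = x + b *: v1 &
      forall t : int, primitive (q + t *: v1)].
Proof.
move=> x1; rewrite -subr_eq0 => v'0.
have [g dg [d v'E]] := SLZ_column_normal_form (v - v i 0 *: x).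
have d0 : (0 < d)%N.
  by case: d v'E v'0 => // ->; rewrite scale0r mulmx0 eqxx.
have [u' u'w] := primitive_SLZ dg.
set w := g *m delta_mx 0 0 in u'w.
have {}v'E : v - v i 0 *: x = d%:Z *: w by rewrite v'E -scalemxAr.
have rowE (y : 'cV[int]_m.+2) : delta_mx 0 i *m y = (y i 0)%:M.
  by rewrite -rowE; apply/matrixP=> a c; rewrite !mxE !ord1 eqxx mulr1n.
have w0 : w i 0 = 0.
  have /matrixP/(_ i 0) := v'E; rewrite !mxE x1 mulr1 subrr => /esym/eqP.
  by rewrite mulf_eq0 => /orP[|/eqP//]; move: d0; case: (d).
(* Dividing v = v_i x + d w by h = gcd(v_i, d) leaves v1 = a0 x + b0 w. *)
have [a0 [b0 [h [r [s [h0 va db rs]]]]]] : exists a0 b0 h r s : int,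
    [/\ h > 0, v i 0 = h * a0, d%:Z = h * b0 & r * a0 + s * b0 = 1].
  have [r [s rs]] := Bezoutz (v i 0) d%:Z.
  have h0 : 0 < gcdz (v i 0) d%:Z.
    by rewrite /gcdz ltz_nat gcdn_gt0 d0 orbT.
  have /dvdzP[a0 aE] := dvdz_gcdl (v i 0) d%:Z.
  have /dvdzP[b0 bE] := dvdz_gcdr (v i 0) d%:Z.
  exists a0, b0, (gcdz (v i 0) d%:Z), r, s; split=> //; try by rewrite mulrC.
  apply: (mulIf (lt0r_neq0 h0)); rewrite mul1r mulrDl -!mulrA.
  by rewrite -aE -bE rs.
have b0gt : 0 < b0 by rewrite -(pmulr_rgt0 _ h0) -db; case: (d) d0.
(* Reducing the Bezout coefficient modulo [b0] gives b < b0, so a linear form at [q] is at most its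
   size at [x] plus its size at [v1]. *)
pose b := ((- r) %% b0)%Z; pose k := ((- r) %/ b0)%Z.
have bE : b = - r - k * b0 by rewrite [X in X - _](divz_eq (- r) b0) addrC addKr.
exists ((s - k * a0) *: x + b *: w), (a0 *: x + b0 *: w), h, b0, b.
have bez : b0 * (s - k * a0) - a0 * b = 1 by rewrite bE -rs; ring.
split.
- rewrite scalerDr !scalerA -va -db -v'E addrC subrK //.
- by rewrite gt_eqF.
- by rewrite modz_ge0 ?gt_eqF //= ltz_pmod.
- rewrite !scalerDr !scalerA.
  have -> : b0 * (s - k * a0) = 1 + b * a0 by rewrite -bez; ring.
  by rewrite scalerDl scale1r addrA [b0 * b]mulrC.
move=> t; rewrite scalerDr !scalerA addrACA -!scalerDl.
(* Subtracting [c] times the i-th coordinate makes [u'] vanish at [x] and keeps its value at [w],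
   where that coordinate is 0. *)
pose c := (u' *m x) 0 0.
apply: (@primitive_comb _ x w (delta_mx 0 i) (u' - c *: delta_mx 0 i) _ _ b0 (- a0)).
- by rewrite rowE x1.
- by rewrite rowE w0 raddf0.
- rewrite mulmxBl -scalemxAl rowE x1 /c; apply/matrixP=> e f.
  rewrite mxE !ord1 [X in _ + X]mxE [X in - X]mxE [X in _ * X]mxE.
  by rewrite mulr1 subrr mxE.
- by rewrite mulmxBl -scalemxAl rowE w0 raddf0 scaler0 subr0.
rewrite -bez; ring.
Qed.

(** * Values at integer points where the linear forms are small *)

Definition form_value (C : comNzRingType) (m n : nat) (L : 'M[C]_(n, m))
  (x : 'cV[C]_m) : C := \prod_(i < n) (L *m x) i ord0.

Lemma exists_nat_nonroot (C : numDomainType) (p : {poly C}) :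
  p != 0 -> exists2 s : nat, (s < size p)%N & p.[s%:R] != 0.
Proof.
move=> p0; pose rs : seq C := [seq i%:R | i <- iota 0 (size p)].
have: ~~ all (root p) rs.
  apply/negP => ap; have := max_poly_roots p0 ap.
  rewrite map_inj_uniq; last by move=> i j /eqP; rewrite eqr_nat => /eqP.
  by rewrite iota_uniq size_map size_iota ltnn => /(_ isT).
rewrite -has_predC => /hasP[_ /mapP[s + ->]] /= ns.
by rewrite mem_iota => ?; exists s.
Qed.

Lemma size_prod_seq_le (C : idomainType) (I : Type) (s : seq I)
    (F : I -> {poly C}) (k : nat) :
  (forall i, size (F i) <= k.+1)%N ->
  (size (\prod_(i <- s) F i)%R <= (k * size s).+1)%N.
Proof.
move=> Fk; elim: s => [|i s IHs]; first by rewrite big_nil size_poly1 muln0.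
rewrite big_cons -[size (_ :: _)]/(size s).+1 mulnS.
apply: leq_trans (size_polyMleq _ _) _.
move: (Fk i) IHs; set F0 := F i; set Fs := bigop _ _ _; lia.
Qed.

Lemma prod_poly_const (C : idomainType) (n : nat) (a b : 'I_n -> C) (c : C) :
  \prod_(i < n) ((a i)%:P + b i *: 'X) = c%:P -> c != 0 -> forall i, b i = 0.
Proof.
move=> PE c0 i; move: PE; rewrite (bigD1 i) //=.
set f := _ + _; set g := \prod_(_ | _) _ => fg.
have fg0 : f * g != 0 by rewrite fg polyC_eq0.
have [f0 g0] : f != 0 /\ g != 0 by apply/andP; rewrite -negb_or -mulf_eq0.
have: (size f + size g).-1 = 1%N by rewrite -size_mul // fg size_polyC c0.
have: (0 < size f)%N by rewrite size_poly_gt0.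
have: (0 < size g)%N by rewrite size_poly_gt0.
move=> ? ? ?; have f1 : (size f <= 1)%N by lia.
have := nth_default 0 f1.
by rewrite /f coefD coefC coefZ coefX /= mulr1 add0r.
Qed.

Lemma form_value_line (C : comNzRingType) (m n : nat) (L : 'M[C]_(n, m))
    (q v : 'cV[C]_m) (t : C) :
  form_value L (q + t *: v) =
  (\prod_(i < n) (((L *m q) i ord0)%:P + (L *m v) i ord0 *: 'X)).[t].
Proof.
rewrite horner_prod; apply: eq_bigr => i _.
by rewrite hornerD hornerC hornerZ hornerX mulmxDr -scalemxAr !mxE [t * _]mulrC.
Qed.

Lemma form_value_scale (C : comNzRingType) (m n : nat) (L : 'M[C]_(n, m))
    (t : C) (v : 'cV[C]_m) :
  form_value L (t *: v) = t ^+ n * form_value L v.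
Proof.
rewrite /form_value -[X in t ^+ X]card_ord -prodr_const -big_split /=.
by apply: eq_bigr => i _; rewrite -scalemxAr !mxE.
Qed.

(** On the moment curve (1, s, s^2, ...) each nonzero row becomes a nonzero polynomial in s, so the
    product has finitely many roots. *)
Lemma exists_int_nonroot (C : numDomainType) (m n : nat)
    (L : 'M[C]_(n, m.+1)) :
  (forall i, row i L != 0) ->
  exists2 x : 'cV[int]_m.+1, x ord0 ord0 = 1 & form_value L (map_mx intr x) != 0.
Proof.
move=> L0; pose P i : {poly C} := \poly_(j < m.+1) L i (inord j).
have : \prod_(i < n) P i != 0.
  apply/prodf_neq0 => i _; apply: contra (L0 i) => /eqP Pi0.
  apply/eqP/rowP => j; rewrite !mxE.
  have := congr1 (fun p : {poly C} => p`_j) Pi0.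
  by rewrite coef_poly ltn_ord inord_val coef0.
move=> /exists_nat_nonroot[s _ sP]; exists (\col_j s%:Z ^+ j).
  by rewrite mxE expr0.
move: sP; rewrite horner_prod; congr (_ != 0); apply: eq_bigr => i _.
rewrite horner_poly mxE; apply: eq_bigr => j _.
by rewrite inord_val !mxE rmorphXn.
Qed.

Lemma uniform_nat_bound (C : numDomainType) (n : nat) (a : 'I_n -> C) :
  (forall z : C, exists k : nat, `|z| <= k%:R) ->
  exists k : nat, forall i, `|a i| <= k%:R.
Proof.
move=> archC; have [k kP] := archC (\sum_i `|a i|); exists k => i.
apply: le_trans kP; rewrite [X in _ <= X]ger0_norm ?sumr_ge0 //.
by rewrite (bigD1 i) //= lerDl sumr_ge0.
Qed.

(* The forms [l_i] cannot be simultaneously small but not all zero at an integer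
   point [v]: otherwise [t |-> f (q + t v1)], with [q] and [v1] from
   [primitive_line], would be a nonconstant polynomial bounded at many integers. *)
Lemma small_integer_vector (C : numFieldType) (m n : nat)
    (L : 'M[C]_(n, m.+2)) :
  (forall z : C, exists k : nat, `|z| <= k%:R) ->
  (forall i, row i L != 0) ->
  (forall k : nat, exists s : seq C, forall p : 'cV[int]_m.+2, primitive p ->
     `|form_value L (map_mx intr p)| <= k%:R -> form_value L (map_mx intr p) \in s) ->
  exists2 N : nat, (0 < N)%N & forall v : 'cV[int]_m.+2,
    (forall i, N%:R * `|(L *m map_mx intr v) i ord0| <= 1) -> L *m map_mx intr v = 0.
Proof.
move=> archC L0 finL; have [x x1 Fx] := exists_int_nonroot L0.
pose l (v : 'cV[int]_m.+2) i := (L *m map_mx intr v) i ord0.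
have lD v w i : l (v + w) i = l v i + l w i by rewrite /l map_mxD mulmxDr mxE.
have lZ (c : int) v i : l (c *: v) i = c%:~R * l v i.
  by rewrite /l map_mxZ -scalemxAr mxE.
have [K0 K0P] := uniform_nat_bound (l x) archC.
have [K1 K1P] := uniform_nat_bound (fun i => (l x i)^-1) archC.
(* Each |l_i(q)| will be at most K0 + 1, and t v1 adds at most 1. *)
have [s sP] := finL ((K0 + 2) ^ n)%N.
pose T := (n * size s)%N.
(* The summand [T] keeps l_i(t v1) small for all t <= T; [K1] excludes nonzero multiples of [x],
   where |l_i| >= 1 / K1. *)
exists (T + K1).+1 => // v vsmall; apply/colP => i0; rewrite [RHS]mxE -/(l v i0).
have lx0 i : l x i != 0 by move: Fx => /prodf_neq0/(_ i isT).
have [vE|] := eqVneq v (v ord0 ord0 *: x).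
  move: (v ord0 ord0) vE => c vE.
  have [c0|c0] := eqVneq c 0; first by rewrite vE lZ c0 mul0r.
  have := vsmall i0; rewrite -/(l _ _) vE lZ normrM.
  have c1 : 1 <= `|c%:~R : C| by rewrite -intr_norm ler1z -gtz0_ge1 normr_gt0.
  have := K1P i0; rewrite normfV => xK1 xN; exfalso.
  have xgt : 0 < `|l x i0| by rewrite normr_gt0.
  have : (T + K1).+1%:R <= (K1%:R : C).
    apply: le_trans xK1; rewrite -[leRHS]mul1r ler_pdivlMr //; apply: le_trans xN.
    by rewrite ler_wpM2l ?ler0n // -[leLHS]mul1r ler_wpM2r.
  by rewrite ler_nat; lia.
move=> /(primitive_line x1)[q [v1 [h [b0 [b [vE h0 /andP[b_ge0 b_lt] qE prim]]]]]].
have v1small i : (T + K1).+1%:R * `|l v1 i| <= 1.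
  apply: le_trans (vsmall i); rewrite -/(l _ _) vE lZ normrM ler_wpM2l ?ler0n //.
  rewrite -[leLHS]mul1r ler_wpM2r //.
  by rewrite -intr_norm ler1z -gtz0_ge1 normr_gt0.
have v1le1 i : `|l v1 i| <= 1.
  apply: le_trans (v1small i); rewrite -[leLHS]mul1r ler_wpM2r // ler1n.
  by [].
have b0_gt0 : 0 < b0 := le_lt_trans b_ge0 b_lt.
have qle i : `|l q i| <= K0.+1%:R.
  have b0C : 0 < (b0%:~R : C) by rewrite ltr0z.
  have b01 : 1 <= (b0%:~R : C) by rewrite ler1z -gtz0_ge1.
  rewrite -(ler_pM2l b0C) -[X in X * `|_|]gtr0_norm // -normrM -lZ qE lD lZ.
  apply: le_trans (ler_normD _ _) _; rewrite -natr1 mulrDr mulr1 lerD //.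
    by apply: le_trans (K0P i) _; rewrite -[leLHS]mul1r ler_wpM2r ?ler0n.
  rewrite normrM -[leRHS]mulr1 ler_pM //.
  by rewrite -intr_norm ler_int ger0_norm // ltW.
have tle i (t : nat) : (t <= T)%N -> `|l (q + t%:Z *: v1) i| <= (K0 + 2)%:R.
  move=> tT; rewrite lD lZ addn2 -natr1; apply: le_trans (ler_normD _ _) _.
  rewrite lerD // normrM; apply: le_trans (v1small i).
  by rewrite ler_wpM2r // -[t%:~R]/(t%:R) normr_nat ler_nat; lia.
pose P : {poly C} := \prod_(i < n) ((l q i)%:P + l v1 i *: 'X).
have PE (t : C) : form_value L (map_mx intr q + t *: map_mx intr v1) = P.[t].
  exact: form_value_line.
have Psize : (size P <= n.+1)%N.
  rewrite -[n in n.+1]mul1n -[n in (_ * n).+1]size_enum_ord /P.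
  rewrite -big_enum; apply: size_prod_seq_le => i.
  apply: leq_trans (size_polyD _ _) _; rewrite geq_max.
  rewrite (leq_trans (size_polyC_leq1 _)) //=.
  by rewrite (leq_trans (size_scale_leq _ _)) ?size_polyX.
(* If [P] vanished, so would the form at x = b0 (q - (b / b0) v1). *)
have P0 : P != 0.
  apply: contraNneq Fx => P0.
  have b0C : (b0%:~R : C) != 0 by rewrite intr_eq0 gt_eqF.
  have -> : map_mx intr x =
      b0%:~R *: (map_mx intr q + (- (b%:~R / b0%:~R)) *: map_mx intr v1) :> 'cV[C]_m.+2.
    have -> : x = b0 *: q - b *: v1 by rewrite qE addrK.
    rewrite map_mxB !map_mxZ scalerDr scalerA mulrN mulrCA divff // mulr1.
    by rewrite scaleNr.
  by rewrite form_value_scale PE P0 horner0 mulr0.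
have [Pc|Pnc] := leqP (size P) 1.
  have PcE := size1_polyC Pc; have c0 : P`_0 != 0 by rewrite -polyC_eq0 -PcE.
  by rewrite vE lZ (prod_poly_const PcE c0) mulr0.
(* [Q] vanishes wherever [P] takes a value in [s]. Its degree is at most [T], so some t <= T is not
   a root, although P(t) must lie in [s]. *)
pose Q := \prod_(c <- s) (P - c%:P).
have Q0 : Q != 0.
  rewrite /Q prodf_seq_neq0; apply/allP => c _ /=; rewrite subr_eq0.
  by apply: contraTneq Pnc => ->; rewrite -leqNgt size_polyC_leq1.
have [t tQ] := exists_nat_nonroot Q0; case/negP.
have tT : (t <= T)%N.
  rewrite -ltnS; apply: leq_trans tQ _; apply: size_prod_seq_le => c.
  apply: leq_trans (size_polyD _ _) _; rewrite geq_max Psize size_polyN.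
  by rewrite (leq_trans (size_polyC_leq1 _)).
have := sP _ (prim t%:Z); rewrite map_mxD map_mxZ (PE t%:R) => ts.
rewrite horner_prod prodf_seq_eq0; apply/hasP; exists P.[t%:R].
  apply: ts; apply: le_trans (_ : (K0 + 2)%:R ^+ n <= _); last by rewrite natrX.
  rewrite -PE -[n in _ ^+ n]card_ord -prodr_const /form_value normr_prod.
  apply: ler_prod => i _; rewrite normr_ge0 /=.
  by have := tle i t tT; rewrite /l map_mxD map_mxZ.
by rewrite /= hornerD hornerN hornerC subrr.
Qed.

(** * Rationality of the common kernel *)

(** As [L] is onto, if l_i(w) <> 0 some x has l_i(x) = - l_i(w) and all other l_j(x) = 1: the form
    vanishes at x + w but not at x. *)
Lemma form_value_period (C : fieldType) (m n : nat) (L : 'M[C]_(n, m))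
    (w : 'cV[C]_m) :
  row_free L -> (forall x, form_value L (x + w) = form_value L x) -> L *m w = 0.
Proof.
move=> Lfree Fw; apply/colP => i; rewrite [RHS]mxE; apply/eqP/negPn/negP => wi.
pose y : 'cV[C]_n := \col_j if j == i then - (L *m w) i ord0 else 1.
have /eqP := Fw (pinvmx L *m y); apply/negP.
rewrite /form_value mulmxDr mulmxA mulmxVp // mul1mx (bigD1 i) //=.
rewrite !mxE eqxx addNr mul0r eq_sym; apply/prodf_neq0 => j _.
by rewrite mxE; case: ifP; rewrite ?oppr_eq0 ?oner_neq0.
Qed.

(* [alpha] is the reduced row echelon form of [L] with pivots at [H]; its rows
   span the same space as those of [L], which [sigma] preserves because it
   preserves the periods of [f]. *)
Lemma echelon_fixed (C : fieldType) (sigma : {rmorphism C -> C}) (m n : nat)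
    (L : 'M[C]_(n, m)) (H : 'M[C]_(m, n)) :
  involutive sigma -> row_free L -> L *m H \in unitmx -> map_mx sigma H = H ->
  (forall x, form_value L (map_mx sigma x) = sigma (form_value L x)) ->
  map_mx sigma (invmx (L *m H) *m L) = invmx (L *m H) *m L.
Proof.
move=> sK Lfree LHu sH Fs; set alpha := invmx _ *m L.
have sKmx p q (A : 'M[C]_(p, q)) : map_mx sigma (map_mx sigma A) = A.
  by apply/matrixP => i j; rewrite !mxE sK.
have LP : L *m (1%:M - H *m alpha) = 0.
  by rewrite mulmxBr mulmx1 /alpha !mulmxA mulmxV // mul1mx subrr.
(* The columns of 1 - H alpha lie in ker L. If [sigma] keeps them there, then L = L H sigma(alpha),
   whence sigma(alpha) = alpha. *)
suff LsP : L *m map_mx sigma (1%:M - H *m alpha) = 0.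
  move: LsP; rewrite map_mxB map_mx1 map_mxM sH mulmxBr mulmx1 => /eqP.
  by rewrite subr_eq0 mulmxA => /eqP LE; rewrite {2}/alpha {2}LE mulKmx.
apply/matrixP => i j; rewrite [RHS]mxE.
have colLE (A : 'M[C]_m) : (L *m A) i j = (L *m col j A) i ord0.
  by rewrite [in RHS]colE mulmxA -colE [RHS]mxE.
rewrite colLE; set w := col j _; suff -> : L *m w = 0 by rewrite mxE.
apply: form_value_period => // x.
have -> : x + w = map_mx sigma (map_mx sigma x + col j (1%:M - H *m alpha)).
  by rewrite map_mxD sKmx /w -map_col.
rewrite Fs -[in RHS](sKmx _ _ x) Fs; congr (sigma _).
by rewrite /form_value mulmxDr colE mulmxA LP mul0mx addr0.
Qed.

(** Dirichlet's pigeonhole argument: N^n + 1 multiples of [a] have their fractional parts in N^n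
    cells of side 1/N. *)
Lemma simultaneous_approximation (R : archiRealFieldType) (n N : nat)
    (a : 'I_n -> R) :
  (0 < N)%N -> exists2 j : nat, (0 < j)%N & exists c : 'I_n -> int,
    forall i, N%:R * `|j%:R * a i - (c i)%:~R| <= 1.
Proof.
case: N => // N _.
pose fl (k : nat) i := Num.floor (k%:R * a i).
pose fr (k : nat) i : R := k%:R * a i - (fl k i)%:~R.
pose cell (k : 'I_(N.+1 ^ n).+1) : {ffun 'I_n -> 'I_N.+1} :=
  [ffun i => inord (Num.truncn (N.+1%:R * fr k i))].
have /injectivePn[x [y xy fxy]] : ~~ injectiveb cell.
  apply/negP => /injectiveP/leq_card.
  by rewrite card_ffun !card_ord ltnn.
wlog {xy} xy : x y fxy / (x < y)%N.
  move=> wl; case: (ltngtP x y) => [|yx|/val_inj/eqP]; first exact: wl.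
    exact: wl yx.
  by rewrite (negbTE xy).
exists (y - x)%N; first by rewrite subn_gt0.
exists (fun i => fl y i - fl x i) => i.
have fr_itv k : 0 <= N.+1%:R * fr k i < N.+1%:R.
  have /andP[k1 k2] := floor_itv (k%:R * a i).
  rewrite mulr_ge0 ?ler0n ?subr_ge0 //= -[ltRHS]mulr1 ltr_pM2l ?ltr0n //.
  by rewrite /fr ltrBlDl addrC -[1]/(1%:~R) addrC -rmorphD.
have -> : (y - x)%:R * a i - (fl y i - fl x i)%:~R = fr y i - fr x i.
  by rewrite natrB ?(ltnW xy) // rmorphB /= /fr; ring.
have := congr1 (fun f : {ffun 'I_n -> 'I_N.+1} => val (f i)) fxy.
have [/andP[x0 xN] /andP[y0 yN]] := (fr_itv x, fr_itv y).
rewrite /= !ffunE !inordK ?truncn_lt_nat // => txy.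
have /andP[x1 x2] := truncn_itv x0; have /andP[y1 y2] := truncn_itv y0.
rewrite -[X in X * `|_|]ger0_norm ?ler0n // -normrM mulrBr ler_norml.
move: x1 x2 y1 y2; rewrite txy -natr1; set u := _%:R; set v := _ * _; set w := _ * _.
by move=> *; apply/andP; split; lra.
Qed.

Lemma complex_archimedean (R : realType) (z : R[i]%C) :
  exists k : nat, `|z| <= k%:R.
Proof.
rewrite normc_def; set x := Num.sqrt _; exists (Num.truncn x).+1.
by rewrite -(rmorph_nat (real_complex R)) lecR ltW // truncnS_gt.
Qed.

Lemma normc_real (R : rcfType) (x : R) : `|real_complex R x| = real_complex R `|x|.
Proof. by rewrite normc_def /= expr0n addr0 sqrtr_sqr. Qed.

(* If [N |l_i v| <= 1] forces [L v = 0] at integer points, then approximating a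
   column of [beta] by rationals with a common denominator is exact. *)
Lemma echelon_rational (R : realType) (m n N : nat) (L : 'M[R[i]%C]_(n, m))
    (H : 'M[int]_(m, n)) (beta : 'M[R]_(n, m)) :
  L *m map_mx intr H \in unitmx ->
  L = L *m map_mx intr H *m map_mx (real_complex R) beta ->
  (forall v : 'cV[int]_m, (forall i, N%:R * `|(L *m map_mx intr v) i ord0| <= 1) ->
     L *m map_mx intr v = 0) -> (0 < N)%N ->
  exists A : 'M[rat]_(n, m), beta = map_mx ratr A.
Proof.
set B := L *m _ => Bu LE small N0.
have B_inj p (x y : 'M[R]_(n, p)) :
  B *m map_mx (real_complex R) x = B *m map_mx (real_complex R) y -> x = y.
  move=> /(congr1 (mulmx (invmx B))); rewrite !mulKmx // => /matrixP xy.
  by apply/matrixP => i j; have := xy i j; rewrite !mxE => /complexI.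
have intrc p q (v : 'M[int]_(p, q)) :
    map_mx (real_complex R) (map_mx intr v) = map_mx intr v.
  by apply/matrixP => i j; rewrite !mxE rmorph_int.
have betaH : beta *m map_mx intr H = 1%:M.
  by apply: B_inj; rewrite map_mxM mulmxA -LE intrc map_mx1 mulmx1.
have [M MP] := uniform_nat_bound (fun i => \sum_r `|B i r|) (@complex_archimedean R).
have entry i k : exists q : rat, beta i k = ratr q.
  (* The rows of |B| sum to at most [M], so precision 1 / (N (M + 1)) in [beta] gives |l_i(y)| <=
     1/N. *)
  have NM : (0 < N * M.+1)%N by rewrite muln_gt0 N0.
  have [j j0 [c cP]] := simultaneous_approximation (fun i => beta i k) NM.
  (* Since beta H = 1, beta y is exactly the error of approximating j times column k by [c]. *)
  pose y : 'cV[int]_m := j%:Z *: delta_mx k ord0 - H *m \col_i c i.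
  have by_ : beta *m map_mx intr y = \col_i (j%:R * beta i k - (c i)%:~R).
    rewrite map_mxB map_mxZ map_mxM mulmxBr mulmxA betaH mul1mx map_delta_mx.
    by rewrite -scalemxAr -colE; apply/colP => r; rewrite !mxE.
  have Ly : L *m map_mx intr y = B *m map_mx (real_complex R) (beta *m map_mx intr y).
    by rewrite map_mxM mulmxA -LE intrc.
  have : L *m map_mx intr y = 0.
    apply: small => i'; rewrite Ly by_ mxE.
    have Mi : \sum_r `|B i' r| <= M.+1%:R.
      apply: le_trans (_ : M%:R <= _); last by rewrite ler_nat.
      by apply: le_trans (MP i'); rewrite ger0_norm ?sumr_ge0.
    have M0 : 0 < (M.+1%:R : R[i]%C) by rewrite ltr0n.
    rewrite -(ler_pM2l M0) mulr1; apply: le_trans Mi.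
    apply: le_trans (ler_wpM2l (ltW M0) (ler_wpM2l (ler0n _ N) (ler_norm_sum _ _ _))) _.
    rewrite !mulr_sumr; apply: ler_sum => r _.
    rewrite normrM !mxE normc_real mulrCA [X in _ * X]mulrCA mulrCA.
    rewrite -[leRHS]mulr1 ler_wpM2l //.
    rewrite -!(rmorph_nat (real_complex R)) -!rmorphM lecR /=.
    by apply: le_trans (cP r); rewrite mulrA -natrM mulnC.
  rewrite Ly => By0.
  have /B_inj : B *m map_mx (real_complex R) (beta *m map_mx intr y) =
    B *m map_mx (real_complex R) 0 by rewrite By0 map_mx0 mulmx0.
  rewrite by_ => /colP/(_ i); rewrite !mxE => /eqP; rewrite subr_eq0 => /eqP jE.
  exists ((c i)%:~R / j%:R).
  rewrite fmorph_div /= rmorph_int rmorph_nat -jE mulrC mulKf //.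
  by rewrite pnatr_eq0 -lt0n.
have [A AE] := fin_all_exists (fun i => fin_all_exists (entry i)).
by exists (\matrix_(i, k) A i k); apply/matrixP => i k; rewrite !mxE AE.
Qed.

(** * Forms as polynomials *)

(** Inverting [row_ebase] clears all columns past the rank, which is at most n; rescaling column 0
    makes the determinant 1. *)
Lemma exists_SL_killing_columns (m n : nat) (A : 'M[rat]_(n, m.+1)) :
  exists2 g : 'M[rat]_m.+1, \det g = 1 &
    forall i (j : 'I_m.+1), (n <= j)%N -> (A *m invmx g) i j = 0.
Proof.
pose E := row_ebase A; have uE : E \in unitmx := row_ebase_unit A.
pose D : 'rV[rat]_m.+1 := \row_j if j == ord0 then \det E else 1.
pose gi := invmx E *m diag_mx D.
have dgi : \det gi = 1.
  rewrite det_mulmx det_inv det_diag big_ord_recl big1 => [|i _]; last by rewrite mxE.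
  by rewrite mxE eqxx mulr1 mulVr // -unitmxE.
exists (invmx gi); first by rewrite det_inv dgi invr1.
move=> i j nj; rewrite invmxK -[A]mulmx_ebase /gi mulmxA mulmxK // mul_mx_diag mxE.
rewrite [X in X * _]mxE big1 ?mul0r // => k _; rewrite mxE.
case: eqP => [/= kj|]; rewrite ?mulr0 //.
by rewrite kj ltnNge (leq_trans (rank_leq_row A) nj) mulr0.
Qed.

Module FormTheory.
Import mpoly.

Lemma rmorph_meval (K K' : comNzRingType) (g : {rmorphism K -> K'}) (m : nat)
    (p : {mpoly K[m]}) (v : 'I_m -> K) :
  g p.@[v] = (map_mpoly g p).@[fun i => g (v i)].
Proof.
rewrite mevalE rmorph_sum [in RHS](mpolyE p) (raddf_sum (map_mpoly g)) raddf_sum.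
apply: eq_bigr => k _ /=.
rewrite map_mpolyZ map_mpolyX mevalZ mevalX rmorphM rmorph_prod; congr (_ * _).
by apply: eq_bigr => i _; rewrite rmorphXn.
Qed.

Lemma map_linear_form (K K' : comUnitRingType) (g : {rmorphism K -> K'}) (m : nat)
    (a : 'rV[K]_m) :
  map_mpoly g (linear_form a) = linear_form (map_mx g a).
Proof.
rewrite /linear_form raddf_sum; apply: eq_bigr => j _ /=.
by rewrite map_mpolyZ map_mpolyX mxE.
Qed.

Lemma linear_form_subst (K : comUnitRingType) (m : nat) (a : 'rV[K]_m)
    (t : m.-tuple {mpoly K[m]}) :
  linear_form a \mPo t = \sum_(j < m) a ord0 j *: tnth t j.
Proof.
rewrite /linear_form raddf_sum; apply: eq_bigr => j _ /=.
by rewrite comp_mpolyZ comp_mpolyXU (tnth_nth 0).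
Qed.

Lemma linear_form_mulmx (K : comUnitRingType) (m : nat) (a : 'rV[K]_m) (B : 'M[K]_m) :
  linear_form a \mPo [tuple linear_form (row i B) | i < m] = linear_form (a *m B).
Proof.
rewrite linear_form_subst /linear_form.
under eq_bigr do rewrite tnth_mktuple scaler_sumr.
rewrite exchange_big; apply: eq_bigr => j _ /=; rewrite mxE scaler_suml.
by apply: eq_bigr => i _; rewrite scalerA mxE.
Qed.

Lemma meval_prod_linear_form (K : comUnitRingType) (m n : nat) (L : 'M[K]_(n, m))
    (x : 'cV[K]_m) :
  (\prod_(i < n) linear_form (row i L)).@[fun j => x j ord0] = form_value L x.
Proof.
rewrite rmorph_prod; apply: eq_bigr => i _; rewrite /= /linear_form raddf_sum mxE.
by apply: eq_bigr => j _ /=; rewrite mevalZ mevalXU mxE.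
Qed.

Lemma prod_linear_form_act (K K' : comUnitRingType) (g : {rmorphism K -> K'})
    (m n : nat) (f : {mpoly K[m]}) (L : 'M[K']_(n, m)) (B : 'M[K]_m) :
  injective g ->
  map_mpoly g f = \prod_(i < n) linear_form (row i L) ->
  map_mpoly g (mpoly_act B f) =
    \prod_(i < n) linear_form (row i (L *m map_mx g (invmx B))).
Proof.
move=> g_inj fE; rewrite /mpoly_act /mpoly_subst map_mpoly_comp // fE rmorph_prod.
apply: eq_bigr => i _ /=; rewrite row_mul -linear_form_mulmx; congr (_ \mPo _).
by apply: eq_from_tnth => j; rewrite tnth_map !tnth_mktuple map_linear_form map_row.
Qed.

(** The identity is tested after the injective change of scalars, where [f] factors. *)
Lemma in_first_variables_prod (K K' : comUnitRingType) (g : {rmorphism K -> K'})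
    (m n k : nat) (f : {mpoly K[m]}) (L : 'M[K']_(n, m)) :
  injective g ->
  map_mpoly g f = \prod_(i < n) linear_form (row i L) ->
  (forall i (j : 'I_m), (k <= j)%N -> L i j = 0) ->
  in_first_variables k f.
Proof.
move=> g_inj fE L0.
have map_inj : injective (@map_mpoly m _ _ g).
  move=> p q pq; apply/mpolyP => u; apply: g_inj.
  by rewrite -!mcoeff_map_mpoly pq.
apply: map_inj; rewrite map_mpoly_comp // fE rmorph_prod; apply: eq_bigr => i _ /=.
rewrite linear_form_subst; apply: eq_bigr => j _.
rewrite tnth_map tnth_mktuple; case: ltnP => [_|kj]; first by rewrite map_mpolyX.
by rewrite mxE L0 // !scale0r.
Qed.

(** The l_i are complex, but their product has real coefficients. *)
Lemma form_value_conj (R : rcfType) (m n : nat) (f : {mpoly R[m]})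
    (L : 'M[R[i]%C]_(n, m)) :
  map_mpoly (real_complex R) f = \prod_(i < n) linear_form (row i L) ->
  forall x, form_value L (map_mx conjc x) = conjc (form_value L x).
Proof.
move=> fE x; rewrite -!meval_prod_linear_form -fE rmorph_meval.
have -> : map_mpoly conjc (map_mpoly (real_complex R) f) = map_mpoly (real_complex R) f.
  by apply/mpolyP => u; rewrite !mcoeff_map_mpoly; exact: conjc_real.
by apply: meval_eq => i; rewrite mxE.
Qed.

Lemma eval_int_form_value (R : rcfType) (m n : nat) (f : {mpoly R[m]})
    (L : 'M[R[i]%C]_(n, m)) :
  map_mpoly (real_complex R) f = \prod_(i < n) linear_form (row i L) ->
  forall z, real_complex R (eval_int f z) = form_value L (map_mx intr z).
Proof.
move=> fE z; rewrite /eval_int rmorph_meval fE -meval_prod_linear_form.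
by apply: meval_eq => i; rewrite mxE rmorph_int.
Qed.

End FormTheory.
Import FormTheory.

(** * Pivots, finiteness from discreteness, and the conclusion *)

Lemma row_free_row_neq0 (K : fieldType) (m n : nat) (L : 'M[K]_(n, m)) i :
  row_free L -> row i L != 0.
Proof.
move=> Lfree; rewrite rowE; apply/negP => /eqP L0.
have: delta_mx ord0 i = 0 :> 'rV[K]_n by apply: (row_free_inj Lfree); rewrite L0 mul0mx.
by move=> /matrixP/(_ ord0 i)/eqP; rewrite !mxE !eqxx oner_eq0.
Qed.

Lemma exists_pivots (K : fieldType) (m n : nat) (L : 'M[K]_(n, m)) :
  row_free L -> exists H : 'M[int]_(m, n), L *m map_mx intr H \in unitmx.
Proof.
move=> Lfree; have LTfull : row_full L^T by rewrite /row_full mxrank_tr.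
pose h := fullrankfun LTfull.
exists (\matrix_(j, i) (j == h i)%:R).
rewrite -unitmx_tr (_ : _^T = rowsub h L^T) ?fullrowsub_unit //.
apply/matrixP => i j; rewrite !mxE (bigD1 (h i)) //= !mxE eqxx mulr1 big1 ?addr0 //.
by move=> k /negbTE kh; rewrite !mxE kh mulr0.
Qed.

From mathcomp Require Import all_classical all_reals all_analysis.
Import numFieldNormedType.Exports.
Local Open Scope classical_set_scope.
Local Open Scope ring_scope.

(** By Bolzano-Weierstrass, an infinite bounded part would have a limit point. *)
Lemma discrete_in_bounded_finite (R : realType) (S : set R) (B : R) :
  discrete_in S -> finite_set (S `&` [set x | `|x| <= B]).
Proof.
move=> dS; apply: contrapT => inf.
have [] := infinite_bounded_limit_point_nonempty inf.
  exists B; split; first exact: num_real.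
  by move=> M BM x [_ /= xB]; exact: le_trans xB (ltW BM).
move=> x xlim; suff: limit_point S x by rewrite dS.
by move=> U /xlim[y [yx [Sy _] Uy]]; exists y.
Qed.

(** [Z] contains [d p] for every primitive [p], and f(d p) = d^n f(p), so the bound [k] becomes d^n
    k on f(Z). *)
Lemma form_values_finite (R : realType) (m n : nat) (f : mpoly.mpoly m.+2 R)
    (L : 'M[R[i]%C]_(n, m.+2)) (Z : set 'cV[int]_m.+2) :
  (forall z, real_complex R (eval_int f z) = form_value L (map_mx intr z)) ->
  Z !=set0 -> Z `<=` [set z | z != 0] -> SLZ_invariant Z ->
  discrete_in (eval_int f @` Z) ->
  forall k : nat, exists s : seq (R[i]%C), forall p : 'cV[int]_m.+2, primitive p ->
    `|form_value L (map_mx intr p)| <= k%:R -> form_value L (map_mx intr p) \in s.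
Proof.
move=> fE [z Zz] Z0 Zinv dZ k.
have [d d0 orb] := SLZ_orbit (Z0 z Zz).
have dC : (d%:R : R[i]%C) ^+ n != 0 by rewrite expf_neq0 // pnatr_eq0 -lt0n.
have /finite_seqP[s sE] :=
  @discrete_in_bounded_finite _ _ ((d ^ n * k)%:R : R) dZ.
exists [seq real_complex R x / d%:R ^+ n | x <- s] => p prim Fk.
have [g dg dp] := orb p prim.
have dF : real_complex R (eval_int f (d%:Z *: p)) =
    d%:R ^+ n * form_value L (map_mx intr p).
  by rewrite fE map_mxZ form_value_scale.
apply/mapP; exists (eval_int f (d%:Z *: p)); last by rewrite dF mulrC mulKf.
have : ((eval_int f @` Z) `&` [set x | `|x| <= (d ^ n * k)%:R])
    (eval_int f (d%:Z *: p)).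
  split; first by exists (d%:Z *: p) => //; rewrite dp; exact: Zinv.
  rewrite /= -lecR -normc_real dF rmorph_nat normrM normrX normr_nat natrM natrX.
  by rewrite ler_wpM2l // exprn_ge0.
by rewrite sE.
Qed.

Theorem theorem1p1 (R : realType) (m n : nat) (f : mpoly.mpoly m R)
    (Z : set 'cV[int]_m) :
  (2 <= m)%N ->
  is_form n f ->
  Z !=set0 ->
  Z `<=` [set z | z != 0] ->
  SLZ_invariant Z ->
  discrete_in (eval_int f @` Z) ->
  Q_equivalent_to_form_in n f.
Proof.
case: m f Z => [|[|m]] // f Z _ [_ [L Lfree fE]] Zn0 Z0 Zinv dZ.
have [N N0 small] := small_integer_vector (@complex_archimedean R)
  (fun i => row_free_row_neq0 i Lfree)
  (form_values_finite (eval_int_form_value fE) Zn0 Z0 Zinv dZ).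
have [H LHu] := exists_pivots Lfree.
set alpha := invmx (L *m map_mx intr H) *m L.
have alphaR : map_mx conjc alpha = alpha.
  apply: echelon_fixed => //; first exact: conjcK.
    by apply/matrixP => i j; rewrite !mxE rmorph_int.
  exact: form_value_conj fE.
pose beta : 'M[R]_(n, m.+2) := map_mx (@complex.Re R) alpha.
have betaE : map_mx (real_complex R) beta = alpha.
  apply/matrixP => i j; have /matrixP/(_ i j) := alphaR; rewrite !mxE => aR.
  by apply/RRe_real; rewrite CrealE; apply/eqP.
have LE : L = L *m map_mx intr H *m map_mx (real_complex R) beta.
  by rewrite betaE mulKVmx.
have [A AE] := echelon_rational LHu LE small N0.
have [g dg Ag] := exists_SL_killing_columns A.
exists (mpoly_act (map_mx ratr g) f); first by exists g.
apply: in_first_variables_prod (prod_linear_form_act _ (@complexI R) fE) _ => //.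
  exact: complexI.
(* L g^-1 = (L H) (A g^-1), whose last factor has zero columns from n on. *)
move=> i j nj; rewrite -map_invmx LE -(mulmxA (L *m _)).
rewrite -map_mxM AE -map_mxM mxE big1 // => k _.
by rewrite 2![in X in _ * X]mxE Ag // !rmorph0 mulr0.
Qed.
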